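(* Consider $\dot x=f(x,u(t))$ on $\mathbb R^{2N}$, semi-contracting on $\mathcal D\subseteq\mathbb R^{2N}$ with respect to $\|\cdot\|_R$ with rate $c>0$. For a nominal input $\bar u\in\mathcal U$, let $x^*(\bar u)\in\mathcal D$ satisfy $\|f(x^*(\bar u),\bar u)\|_R=0$. Consider a time-varying input $u(t)$ satisfying $\|u(t)-\bar u\|_2\le\delta$ for all $t\ge0$, and set $x_c(t):=x^*(\bar u)$. Assume that the vector field is uniformly Lipschitz in the input at the nominal manifold, namely $$\|f(x^*(\bar u),u)-f(x^*(\bar u),\bar u)\|_R\le L_u\|u-\bar u\|_2\qquad\text{for all }u\in\mathcal U .$$ Then, for all $t\ge0$, the deviation satisfies $$\inf_{v\in\ker(R)}\|x(t)-(x_c(t)+v)\|_R\le e^{-ct}\rho(0)+\frac{L_u\delta}{c}\big(1-e^{-ct}\big),$$ where $\rho(0)\ge\inf_{v\in\ker(R)}\|x(0)-(x_c(0)+v)\|_R$. Consequently, $$\limsup_{t\to\infty}\ \inf_{v\in\ker(R)}\|x(t)-(x_c(t)+v)\|_R\le\frac{L_u\delta}{c}.$$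
   Context: $N\ge2$. $R_\theta\in\mathbb R^{(N-1)\times N}$ has orthonormal rows spanning $\mathrm{span}\{\mathbf 1_N\}^\perp$; $R:=\mathrm{blkdiag}(R_\theta,I_N)\in\mathbb R^{(2N-1)\times2N}$; $\|x\|_R:=\|Rx\|_2$ is a seminorm on $\mathbb R^{2N}$ with kernel $\ker(R)=\mathrm{span}\{[\mathbf 1_N^\top,\mathbf 0_N^\top]^\top\}$. $\mathcal U\subseteq\mathbb R^{2N}$ is the admissible input set, in which $u(t)$ takes its values. $f(x,u)$ is continuously differentiable in $x\in\mathbb R^{2N}$ with Jacobian $D_xf(x,u)$. For $A\in\mathbb R^{2N\times2N}$, $\|A\|_R:=\max\{\|Az\|_R: z\perp\ker(R),\ \|z\|_R=1\}$ and $\mu_R(A):=\lim_{h\to0^+}\frac{\|I+hA\|_R-1}{h}$, which equals $\lambda_{\max}\big(\tfrac12(RAR^\top+RA^\top R^\top)\big)$. The domain $\mathcal D$ is convex, and semi-contracting on $\mathcal D$ with rate $c>0$ with respect to $\|\cdot\|_R$ means $\mu_R(D_xf(x,u(t)))\le -c$ for all $x\in\mathcal D$, $t\ge0$. Standing property of the systems considered: $D_xf(x,u(t))\ker(R)\subseteq\ker(R)$ for all $x\in\mathcal D$, $t\ge0$. $x(t)$ denotes a solution of $\dot x=f(x,u(t))$, and $L_u$ is a constant.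
   Formalization: The formal statement adds that the solution x(t) stays in the domain D for all t ≥ 0 and that the Lipschitz constant L_u is nonnegative; without these the claim fails (e.g. a solution starting outside D, where nothing is contracting). *)

(* Defs.v *)
From HB Require Import structures.
From mathcomp Require Import all_boot all_order all_algebra.
From mathcomp Require Import all_classical all_reals all_analysis.

Set Implicit Arguments.
Unset Strict Implicit.
Unset Printing Implicit Defensive.

Import Order.TTheory GRing.Theory Num.Theory.
Import numFieldNormedType.Exports.

Local Open Scope classical_set_scope.
Local Open Scope ring_scope.

(* The norm that the library puts on matrices is the sup norm, so the Euclidean
   norm is defined here; the two induce the same topology. *)
Definition norm2 (K : realType) (n : nat) (x : 'cV[K]_n) : K :=
  Num.sqrt (\sum_(i < n) x i 0 ^+ 2).

Definition ones_perp_basis (K : realType) (N : nat) (Rt : 'M[K]_(N.-1, N)) :=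
  Rt *m Rt^T = 1%:M /\
  forall w : 'rV[K]_N, (w <= Rt)%MS <-> \sum_(j < N) w 0 j = 0.

Definition Rmat (K : realType) (N : nat) (Rt : 'M[K]_(N.-1, N)) :
    'M[K]_(N.-1 + N, N + N) :=
  block_mx Rt 0 0 1%:M.

Section Seminorm.
Context {K : realType} {m n : nat}.
Variable R : 'M[K]_(m, n).

Definition seminorm (x : 'cV[K]_n) : K := norm2 (R *m x).

Definition ker : set 'cV[K]_n := [set v | R *m v = 0].

Definition perp_ker : set 'cV[K]_n :=
  [set z | forall v, ker v -> \sum_(i < n) z i 0 * v i 0 = 0].

(* The supremum is a maximum as soon as R <> 0, the set of admissible z being
   then compact and nonempty. *)
Definition mxseminorm (A : 'M[K]_n) : K :=
  sup [set seminorm (A *m z) | z in perp_ker `&` [set z | seminorm z = 1]].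

Definition log_seminorm (A : 'M[K]_n) : K :=
  lim ((mxseminorm (1%:M + h *: A) - 1) / h @[h --> 0^'+]).

Definition dist_ker (x y : 'cV[K]_n) : K :=
  inf [set seminorm (x - (y + v)) | v in ker].

End Seminorm.

(* Entry (i, j) is the partial derivative of the i-th component along the j-th
   coordinate; the library's [jacobian] is its transpose, for row vectors. *)
Definition Jac (K : realType) (n : nat) (g : 'cV[K]_n -> 'cV[K]_n)
    (p : 'cV[K]_n) : 'M[K]_n :=
  \matrix_(i, j) ('D_(delta_mx j 0) g p) i 0.

Definition C1 (K : realType) (n : nat) (g : 'cV[K]_n -> 'cV[K]_n) :=
  (forall p, differentiable g p) /\ continuous (Jac g).

Definition semi_contracting (K : realType) (m n k : nat) (R : 'M[K]_(m, n))
    (f : 'cV[K]_n -> 'cV[K]_k -> 'cV[K]_n) (u : K -> 'cV[K]_k)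
    (D : set 'cV[K]_n) (c : K) :=
  forall x (t : K), D x -> 0 <= t -> log_seminorm R (Jac (f ^~ (u t)) x) <= - c.

Definition ker_invariant (K : realType) (m n k : nat) (R : 'M[K]_(m, n))
    (f : 'cV[K]_n -> 'cV[K]_k -> 'cV[K]_n) (u : K -> 'cV[K]_k)
    (D : set 'cV[K]_n) :=
  forall x (t : K) v, D x -> 0 <= t -> ker R v -> ker R (Jac (f ^~ (u t)) x *m v).

(* Classical solution on [0, +oo[. Continuity at 0 from the right replaces a
   derivative at the end point, so nothing is asked of x at negative times. *)
Definition solution (K : realType) (n k : nat)
    (f : 'cV[K]_n -> 'cV[K]_k -> 'cV[K]_n) (u : K -> 'cV[K]_k)
    (x : K -> 'cV[K]_n) :=
  {within `[0, +oo[, continuous x} /\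
  forall t : K, 0 < t -> is_derive t 1 x (f (x t) (u t)).

(* Main.v *)
Require Import Defs.
From HB Require Import structures.
From mathcomp Require Import all_boot all_order all_algebra.
From mathcomp Require Import all_classical all_reals all_analysis.
From mathcomp Require Import ring lra.
Import Order.TTheory GRing.Theory Num.Theory.
Import numFieldNormedType.Exports.
Local Open Scope classical_set_scope.
Local Open Scope ring_scope.

(* Since [R] has orthonormal rows, the distance to [p + ker R] is the seminorm
   of [x - p], and [R^T *m R] projects onto the complement of [ker R].
   Cauchy-Schwarz in the difference quotient of the log-seminorm [mu] gives
   <Rz, RAz> <= mu(A) |Rz|^2 for every [A] preserving [ker R].  By the mean value
   theorem along the segment from p = x*(ubar) to x(t), V = |R(x - p)|^2
   satisfies V' <= 2 (Lu delta sqrt V - c V), and Gronwall's comparison applied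
   to sqrt V concludes. *)

(** * Euclidean inner product and norm *)

Definition dot {K : realType} {n : nat} (u v : 'cV[K]_n) : K := (u^T *m v) 0 0.

Section EuclideanSpace.
Context {K : realType} {n : nat}.
Implicit Types u v w : 'cV[K]_n.

Lemma dotE u v : dot u v = \sum_(i < n) u i 0 * v i 0.
Proof. by rewrite /dot mxE; apply: eq_bigr => i _; rewrite mxE. Qed.

Lemma dotC u v : dot u v = dot v u.
Proof. by rewrite !dotE; apply: eq_bigr => i _; rewrite mulrC. Qed.

Lemma dotDr u v w : dot u (v + w) = dot u v + dot u w.
Proof. by rewrite /dot mulmxDr mxE. Qed.

Lemma dotZr a u v : dot u (a *: v) = a * dot u v.
Proof. by rewrite /dot -scalemxAr mxE. Qed.

Lemma dotBr u v w : dot u (v - w) = dot u v - dot u w.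
Proof. by rewrite dotDr -scaleN1r dotZr mulN1r. Qed.

Lemma dotDl u v w : dot (u + v) w = dot u w + dot v w.
Proof. by rewrite dotC dotDr !(dotC w). Qed.

Lemma dotZl a u v : dot (a *: u) v = a * dot u v.
Proof. by rewrite dotC dotZr dotC. Qed.

Lemma dotBl u v w : dot (u - v) w = dot u w - dot v w.
Proof. by rewrite dotC dotBr !(dotC w). Qed.

Lemma dot0r u : dot u 0 = 0.
Proof. by rewrite /dot mulmx0 mxE. Qed.

Lemma dotvv_ge0 u : 0 <= dot u u.
Proof. by rewrite dotE sumr_ge0// => i _; rewrite -expr2 sqr_ge0. Qed.

Lemma norm2E u : norm2 u = Num.sqrt (dot u u).
Proof. by rewrite /norm2 dotE; under [in RHS]eq_bigr do rewrite -expr2. Qed.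

Lemma norm2_ge0 u : 0 <= norm2 u.
Proof. exact: sqrtr_ge0. Qed.

Lemma sqr_norm2 u : norm2 u ^+ 2 = dot u u.
Proof. by rewrite norm2E sqr_sqrtr// dotvv_ge0. Qed.

Lemma dotvv_eq0 u : dot u u = 0 -> u = 0.
Proof.
rewrite dotE => /eqP; rewrite psumr_eq0 => [/allP u0|i _]; last first.
  by rewrite -expr2 sqr_ge0.
apply/colP => i; rewrite mxE; apply/eqP.
by have := u0 i (mem_index_enum i); rewrite mulf_eq0 orbb.
Qed.

Lemma norm2_eq0 u : norm2 u = 0 -> u = 0.
Proof. by move=> u0; apply: dotvv_eq0; rewrite -sqr_norm2 u0 expr0n. Qed.

Lemma norm2Z a u : norm2 (a *: u) = `|a| * norm2 u.
Proof.
by rewrite !norm2E dotZl dotZr mulrA -expr2 sqrtrM ?sqr_ge0// sqrtr_sqr.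
Qed.

(** Cauchy-Schwarz: expand the square of [norm2 v *: u - norm2 u *: v], then divide by the product
    of the norms. *)
Lemma dot_le_norm2 u v : dot u v <= norm2 u * norm2 v.
Proof.
have [/norm2_eq0 ->|u0] := eqVneq (norm2 u) 0.
  by rewrite dotC dot0r mulr_ge0// norm2_ge0.
have [/norm2_eq0 ->|v0] := eqVneq (norm2 v) 0.
  by rewrite dot0r mulr_ge0// norm2_ge0.
have a0 : 0 < norm2 u * norm2 v by rewrite mulr_gt0// lt_def norm2_ge0 ?u0 ?v0.
have := dotvv_ge0 (norm2 v *: u - norm2 u *: v).
rewrite dotBl !dotBr !dotZl !dotZr -!sqr_norm2 (dotC v u) => h.
rewrite -(ler_pM2l a0); nra.
Qed.

Lemma ler_norm2D u v : norm2 (u + v) <= norm2 u + norm2 v.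
Proof.
rewrite -(@ler_pXn2r _ 2)// ?nnegrE ?addr_ge0 ?norm2_ge0//.
rewrite sqr_norm2 dotDl !dotDr -!sqr_norm2 (dotC v u) sqrrD.
by have := dot_le_norm2 u v; lra.
Qed.

End EuclideanSpace.

Lemma dot_mull {K : realType} {m n : nat} (M : 'M[K]_(m, n)) u v :
  dot u (M *m v) = dot (M^T *m u) v.
Proof. by rewrite /dot trmx_mul trmxK mulmxA. Qed.

Lemma mulmx_coordE {K : realType} {m n : nat} (M : 'M[K]_(m, n)) y i :
  (M *m y) i 0 = dot (row i M)^T y.
Proof. by rewrite /dot trmxK -row_mul [in RHS]mxE. Qed.

(** The Frobenius norm serves as [C], by Cauchy-Schwarz on each row. This bound makes the supremum
    in [mxseminorm] finite. *)
Lemma norm2_mulmx_bounded {K : realType} {m n : nat} (M : 'M[K]_(m, n)) :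
  exists C : K, forall y, norm2 (M *m y) <= C * norm2 y.
Proof.
exists (Num.sqrt (\sum_(i < m) norm2 (row i M)^T ^+ 2)) => y.
rewrite -[norm2 y]ger0_norm ?norm2_ge0// -sqrtr_sqr -sqrtrM; last first.
  by rewrite sumr_ge0// => i _; rewrite sqr_ge0.
rewrite norm2E ler_sqrt; last first.
  by rewrite mulr_ge0 ?sqr_ge0// sumr_ge0// => i _; rewrite sqr_ge0.
rewrite dotE mulr_suml ler_sum// => i _.
rewrite mulmx_coordE.
have hC := dot_le_norm2 (row i M)^T y.
have hN := dot_le_norm2 (- (row i M)^T) y.
have nN : norm2 (- (row i M)^T) = norm2 (row i M)^T.
  by rewrite -scaleN1r norm2Z normrN1 mul1r.
rewrite nN -scaleN1r dotZl mulN1r in hN.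
rewrite -expr2 -exprMn -[_ ^+ 2]real_normK ?num_real//.
by rewrite ler_pXn2r ?nnegrE ?mulr_ge0 ?norm2_ge0// ler_norml; apply/andP; split; lra.
Qed.

(** * Matrix seminorm and log-seminorm *)

Section LogSeminorm.
Context {K : realType} {m n : nat} {R : 'M[K]_(m, n)}.
Hypothesis RRt : R *m R^T = 1%:M.
Implicit Types (A : 'M[K]_n) (z : 'cV[K]_n).

Lemma mulmx_proj z : R *m (R^T *m (R *m z)) = R *m z.
Proof. by rewrite !mulmxA RRt mul1mx. Qed.

Lemma perp_ker_tr y : perp_ker R (R^T *m y).
Proof.
by move=> v; rewrite /ker/= => Rv0; rewrite -dotE dotC dot_mull trmxK Rv0 dotC dot0r.
Qed.

(** The difference of the two sides lies in the kernel and in its orthogonal complement, hence is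
    orthogonal to itself. *)
Lemma perp_kerK z : perp_ker R z -> R^T *m (R *m z) = z.
Proof.
move=> zp; apply/esym/subr0_eq/dotvv_eq0.
have kz : ker R (z - R^T *m (R *m z)).
  by rewrite /ker/= mulmxBr mulmx_proj subrr.
by rewrite dotBl dotE zp// dotE (perp_ker_tr (R *m z))// subrr.
Qed.

(** On the complement of the kernel, [R *m A *m z] is [R *m A *m R^T] applied to the unit vector
    [R *m z], so the set under [sup] is bounded above. *)
Lemma mxseminorm_ge A z : perp_ker R z -> seminorm R z = 1 ->
  seminorm R (A *m z) <= mxseminorm R A.
Proof.
move=> zp z1; apply: ub_le_sup; last by exists z.
have [C hC] := norm2_mulmx_bounded (R *m A *m R^T).
exists C => _ [y [yp /= y1] <-].
by have := hC (R *m y); rewrite -!mulmxA perp_kerK// -/(seminorm R y) y1 mulr1.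
Qed.

(** The vector [z0] witnesses that the set is nonempty; on the empty set [sup] is a default
    value. *)
Lemma mxseminorm_le A (C : K) z0 : perp_ker R z0 -> seminorm R z0 = 1 ->
  (forall z, perp_ker R z -> seminorm R z = 1 -> seminorm R (A *m z) <= C) ->
  mxseminorm R A <= C.
Proof.
move=> z0p z01 hC; apply: ge_sup; first by exists (seminorm R (A *m z0)), z0.
by move=> _ [z [zp /= z1] <-]; exact: hC.
Qed.

(* The difference quotient defining [log_seminorm] is nondecreasing in [h] and
   bounded below, so that the limit exists. *)
Lemma dot_le_log_seminorm_unit A z : perp_ker R z -> seminorm R z = 1 ->
  dot (R *m z) (R *m (A *m z)) <= log_seminorm R A.
Proof.
move=> zp z1.
pose q h := (mxseminorm R (1%:M + h *: A) - 1) / h.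
(* Cauchy-Schwarz of [R (I + hA) z] against the unit vector [R z]. *)
have q_ge h : 0 < h -> dot (R *m z) (R *m (A *m z)) <= q h.
  move=> h0; rewrite ler_pdivlMr// lerBrDr.
  apply: (le_trans _ (mxseminorm_ge (1%:M + h *: A) _ zp z1)).
  have := dot_le_norm2 (R *m z) (R *m ((1%:M + h *: A) *m z)).
  rewrite -/(seminorm R z) z1 mul1r; apply: le_trans.
  rewrite mulmxDl mul1mx mulmxDr dotDr -sqr_norm2 -/(seminorm R z) z1 expr1n.
  by rewrite -scalemxAl -scalemxAr dotZr addrC mulrC.
have q_homo h k : 0 < h -> h <= k -> q h <= q k.
  move=> h0 hk; have k0 : 0 < k by exact: lt_le_trans hk.
  rewrite /q ler_pdivrMr// mulrAC -mulrA lerBlDr.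
  apply: (mxseminorm_le _ _ _ zp z1) => y yp y1.
  (* For [h <= k], [I + hA] is a convex combination of [I] and [I + kA]; monotonicity then follows
     from the triangle inequality. *)
  have -> : (1%:M + h *: A) *m y =
      (1 - h / k) *: y + (h / k) *: ((1%:M + k *: A) *m y).
    rewrite !mulmxDl !mul1mx -!scalemxAl scalerDr scalerA divfK ?gt_eqF//.
    by rewrite addrA -scalerDl subrK scale1r.
  rewrite /seminorm mulmxDr; apply: (le_trans (ler_norm2D _ _)).
  rewrite -!scalemxAr !norm2Z -/(seminorm R y) y1 mulr1.
  have hk0 : 0 <= h / k by rewrite divr_ge0// ltW.
  have hk1 : 0 <= 1 - h / k by rewrite subr_ge0 ler_pdivrMr// mul1r.
  rewrite !ger0_norm//.
  have := ler_wpM2l hk0 (mxseminorm_ge (1%:M + k *: A) _ yp y1).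
  by rewrite /seminorm; lra.
apply: limr_ge; last first.
  by near=> h; apply: q_ge; near: h; exact: nbhs_right_gt.
apply: nondecreasing_at_right_is_cvgr.
  apply: nearW => b h k; rewrite !in_itv/= => /andP[h0 _] _; exact: q_homo.
apply: nearW => b; exists (dot (R *m z) (R *m (A *m z))) => _ [h + <-].
by rewrite /= in_itv/= => /andP[h0 _]; exact: q_ge.
Unshelve. all: by end_near. Qed.

(** Reduction to the unit vector [y] of the complement, which differs from [r^-1 *: z] by a kernel
    vector; invariance of the kernel makes this difference invisible to [R *m A]. *)
Lemma dot_le_log_seminorm A z : (forall v, ker R v -> ker R (A *m v)) ->
  dot (R *m z) (R *m (A *m z)) <= log_seminorm R A * seminorm R z ^+ 2.
Proof.
move=> Aker; pose r := seminorm R z.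
have [r0|r0] := eqVneq r 0.
  by rewrite -/r r0 expr0n mulr0 (norm2_eq0 _ r0) dotC dot0r.
have rp : 0 < r by rewrite lt_def r0 norm2_ge0.
pose y := r^-1 *: (R^T *m (R *m z)).
have Ry : R *m y = r^-1 *: (R *m z) by rewrite -scalemxAr mulmx_proj.
have yp : perp_ker R y by rewrite /y scalemxAr; exact: perp_ker_tr.
have y1 : seminorm R y = 1.
  by rewrite /seminorm Ry norm2Z gtr0_norm ?invr_gt0// mulVf.
have RAy : R *m (A *m y) = r^-1 *: (R *m (A *m z)).
  apply/subr0_eq; rewrite !scalemxAr -!mulmxBr.
  by apply: Aker; rewrite /ker/= mulmxBr Ry -scalemxAr subrr.
have := dot_le_log_seminorm_unit A _ yp y1.
rewrite Ry RAy dotZl dotZr mulrA -expr2 exprVn mulrC ler_pdivrMr ?exprn_gt0//.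
Qed.

End LogSeminorm.

(** * Derivatives of vector-valued functions *)

Section MatrixValuedDerivative.
Context {K : realType} {V : normedModType K}.

Lemma is_derive_coord (m n : nat) (h : V -> 'M[K]_(m, n)) t v
    (dh : 'M[K]_(m, n)) i j :
  is_derive t v h dh -> is_derive t v (fun x => h x i j) (dh i j).
Proof.
move=> [hd <-]; apply: DeriveDef; first exact: (derivable_mxP _ _ _).1.
by rewrite derive_mx// mxE.
Qed.

Lemma is_derive_mx (m n : nat) (h : V -> 'M[K]_(m, n)) t v
    (dh : 'M[K]_(m, n)) :
  (forall i j, is_derive t v (fun x => h x i j) (dh i j)) -> is_derive t v h dh.
Proof.
move=> hd; have dhd : derivable h t v by apply/derivable_mxP => i j; case: (hd i j).
apply: DeriveDef => //; rewrite derive_mx//; apply/matrixP => i j.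
by rewrite mxE; case: (hd i j).
Qed.

Lemma is_derive_dot (n : nat) (f g : V -> 'cV[K]_n) t v df dg :
  is_derive t v f df -> is_derive t v g dg ->
  is_derive t v (fun x => dot (f x) (g x)) (dot (f t) dg + dot df (g t)).
Proof.
move=> fd gd.
have -> : (fun x => dot (f x) (g x)) =
    \sum_(i < n) ((fun x => f x i 0) * (fun x => g x i 0)).
  by apply/funext => x; rewrite dotE fct_sumE.
apply: is_derive_eq.
  apply: is_derive_sum => i.
  by apply: is_deriveM; apply: is_derive_coord.
rewrite !dotE -big_split/=; apply: eq_bigr => i _.
by congr (_ + _); rewrite /GRing.scale/= mulrC.
Qed.

Lemma is_derive_mulmx (m n : nat) (M : 'M[K]_(m, n)) (h : V -> 'cV[K]_n) t v dh :
  is_derive t v h dh -> is_derive t v (fun x => M *m h x) (M *m dh).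
Proof.
move=> hd; apply: is_derive_mx => i j; rewrite ord1.
rewrite mulmx_coordE; under eq_fun do rewrite mulmx_coordE.
apply: is_derive_eq.
  exact: (is_derive_dot _ (cst (row i M)^T) _ _ _ _ _ (is_derive_cst _ _ _) hd).
by rewrite (dotC 0) dot0r addr0.
Qed.

End MatrixValuedDerivative.

(** * Jacobians and the one-sided Lipschitz estimate *)

Lemma derive_Jac {K : realType} {n : nat} (g : 'cV[K]_n -> 'cV[K]_n) p e :
  differentiable g p -> 'D_e g p = Jac g p *m e.
Proof.
move=> dg; rewrite deriveE//.
(* The differential is linear, so its values on the canonical basis, the columns of the Jacobian,
   determine it. *)
have {1}-> : e = \sum_(j < n) e j 0 *: delta_mx j 0.
  by rewrite [LHS]matrix_sum_delta; apply: eq_bigr => j _; rewrite big_ord1.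
rewrite linear_sum; apply/colP => i; rewrite summxE mxE.
by apply: eq_bigr => j _; rewrite linearZ !mxE deriveE// mulrC.
Qed.

Lemma is_derive_line {K : realType} {n : nat} (g : 'cV[K]_n -> 'cV[K]_n) y e (s : K) :
  differentiable g (y + s *: e) ->
  is_derive s (1 : K) (fun s => g (y + s *: e)) (Jac g (y + s *: e) *m e).
Proof.
move=> dg; rewrite -derive_Jac//.
have E : (fun h : K => h^-1 *: (((fun s => g (y + s *: e)) \o shift s) (h *: (1 : K))
      - g (y + s *: e))) =
    (fun h : K => h^-1 *: ((g \o shift (y + s *: e)) (h *: e) - g (y + s *: e))).
  apply/funext => h /=; congr (_ *: (g _ - _)).
  by rewrite [h%:A]mulr1 scalerDl addrCA.
by apply: DeriveDef; rewrite /derivable/derive E//; exact: diff_derivable.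
Qed.

Lemma convex_set_line {K : realType} {n : nat} (D : set 'cV[K]_n) x y (s : K) :
  convex_set D -> D x -> D y -> 0 <= s <= 1 -> D (y + s *: (x - y)).
Proof.
move=> Dconv Dx Dy /andP[s0 s1].
have := Dconv x y (Itv01 s0 s1); rewrite !inE => /(_ Dx Dy).
congr D; rewrite /conv/= scalerBl scale1r scalerBr.
by rewrite [LHS]addrCA.
Qed.

(** The mean value theorem has no equality form for vector-valued maps; it is applied to the scalar
    function [phi], the pairing with the fixed vector [R *m e]. Convexity keeps the intermediate
    point in [D]. *)
Lemma contracting_one_sided_lipschitz {K : realType} {m n : nat} (R : 'M[K]_(m, n))
    (g : 'cV[K]_n -> 'cV[K]_n) (D : set 'cV[K]_n) (c : K) x y :
  R *m R^T = 1%:M -> convex_set D -> (forall p, differentiable g p) ->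
  (forall p, D p -> log_seminorm R (Jac g p) <= - c) ->
  (forall p v, D p -> ker R v -> ker R (Jac g p *m v)) ->
  D x -> D y ->
  dot (R *m (x - y)) (R *m (g x - g y)) <= - c * seminorm R (x - y) ^+ 2.
Proof.
move=> RRt Dconv dg gc gker Dx Dy; set e := x - y.
pose phi s := dot (R *m e) (R *m g (y + s *: e)).
have phid (s : K) : is_derive s (1 : K) phi
    (dot (R *m e) (R *m (Jac g (y + s *: e) *m e))).
  apply: is_derive_eq.
    apply: (is_derive_dot _ (cst (R *m e))).
    by apply: is_derive_mulmx; exact: is_derive_line.
  by rewrite (dotC 0) dot0r addr0.
have [|s /[!in_itv]/= /andP[s0 s1]] := @MVT _ phi _ 0 1 ltr01 (fun s _ => phid s).
  by apply: derivable_within_continuous => s _; case: (phid s).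
have yeE : y + e = x by rewrite addrC subrK.
rewrite subr0 mulr1 /phi scale0r addr0 scale1r yeE.
rewrite [R *m (g x - _)]mulmxBr dotBr => ->.
have Ds : D (y + s *: e) by apply: convex_set_line => //; rewrite !ltW.
apply: (le_trans (dot_le_log_seminorm RRt _ _ (fun v => gker _ v Ds))).
by rewrite ler_wpM2r ?sqr_ge0// gc.
Qed.

(** * Gronwall comparison for a square root *)

(* [Num.sqrt V] need not be differentiable where [V] vanishes; the estimate is
   proved for [Num.sqrt (V + eps ^+ 2)], whose rate of change is at most
   [c * eps + b - c * Num.sqrt (V + eps ^+ 2)], and eps is then sent to 0. *)
Lemma gronwall_sqrt {K : realType} (V dV : K -> K) (b c : K) :
  0 < c -> 0 <= b -> {within `[0, +oo[, continuous V} ->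
  (forall t, 0 <= t -> 0 <= V t) ->
  (forall t : K, 0 < t -> is_derive t 1 V (dV t)) ->
  (forall t, 0 < t -> dV t <= 2 * (b * Num.sqrt (V t) - c * V t)) ->
  forall t, 0 <= t -> Num.sqrt (V t) <=
    expR (- (c * t)) * Num.sqrt (V 0) + b / c * (1 - expR (- (c * t))).
Proof.
move=> c0 b0 Vcont V0 Vd Vle t t0; apply/ler_addgt0Pr => eps eps0.
(* [k] is the equilibrium of the comparison equation [S' = c * eps + b - c * S], and [exp (c s)] is
   its integrating factor, so [W] is nonincreasing. *)
pose S s := Num.sqrt (V s + eps ^+ 2); pose k := b / c + eps.
pose W s := expR (c * s) * (S s - k).
have e2 : 0 < eps ^+ 2 by rewrite exprn_gt0.
have Spos s : 0 <= s -> 0 < V s + eps ^+ 2 by move=> s0; rewrite ltr_wpDl// V0.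
have Wd (s : K) : 0 < s -> is_derive s (1 : K) W
    (expR (c * s) * ((2 * S s)^-1 * dV s + c * (S s - k))).
  move=> s0; have Vds := Vd _ s0.
  have Sds : is_derive s (1 : K) S ((2 * S s)^-1 * dV s).
    apply: (@is_derive1_comp _ Num.sqrt (fun s => V s + eps ^+ 2)).
      by apply: is_derive1_sqrt; rewrite Spos// ltW.
    by apply: is_derive_eq; rewrite addr0.
  have eds : is_derive s (1 : K) (fun s => expR (c * s)) (expR (c * s) * c).
    apply: (@is_derive1_comp _ expR (fun s => c * s)).
    by apply: is_derive_eq; rewrite [c%:A]mulr1.
  have -> : W = (fun s => expR (c * s)) * (S - cst k) by [].
  by apply: is_derive_eq; rewrite subr0 /GRing.scale/= !fctE; ring.
have Wcont : {within `[0, +oo[, continuous W}.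
  have Scont : {within `[0, +oo[, continuous S}.
    apply: (@within_continuous_comp _ _ _ _ (fun s => V s + eps ^+ 2) Num.sqrt).
      by move=> s _; exact: sqrt_continuous.
    by move=> s; apply: cvgD; [exact: Vcont|exact: cvg_cst].
  move=> s; apply: cvgM; last by apply: cvgB; [exact: Scont|exact: cvg_cst].
  apply: continuous_subspaceT => {}s.
  apply: continuous_comp; last exact: continuous_expR.
  exact: mulrl_continuous.
have Wle : W t <= W 0.
  apply: (@ler0_derive1_le_cc _ W 0 t); rewrite ?in_itv/= ?lexx ?t0//.
  - by move=> s; rewrite in_itv/= => /andP[s0 _]; case: (Wd s s0).
  - move=> s; rewrite in_itv/= => /andP[s0 _]; rewrite derive1E.
    rewrite (@derive_val _ _ _ _ _ _ _ (Wd s s0)) pmulr_rle0 ?expR_gt0//.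
    have Vs := V0 s (ltW s0); have S0 : 0 < S s by rewrite sqrtr_gt0 Spos// ltW.
    have S2 : S s ^+ 2 = V s + eps ^+ 2 by rewrite sqr_sqrtr// ltW// Spos// ltW.
    have VS : Num.sqrt (V s) <= S s by rewrite ler_sqrt ?lerDl ?ltW// Spos// ltW.
    have eS : eps <= S s.
      by rewrite -(ger0_norm (ltW eps0)) -sqrtr_sqr ler_sqrt ?lerDr// ltW// Spos// ltW.
    (* Multiplying by [S s] clears the denominator; what remains is at most
       [b (sqrt V - S) + c eps (eps - S)], and both terms are nonpositive. *)
    rewrite -(pmulr_rle0 _ S0).
    have -> : S s * ((2 * S s)^-1 * dV s + c * (S s - k)) =
        dV s / 2 + S s * (c * S s - b - c * eps).
      by rewrite /k; field; rewrite !gt_eqF.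
    have := Vle s s0; have := ler_wpM2l b0 VS.
    have := ler_wpM2l (ltW (mulr_gt0 c0 eps0)) eS.
    have : c * S s ^+ 2 = c * (V s + eps ^+ 2) by rewrite S2.
    lra.
  - by apply: (continuous_subspaceW _ Wcont); apply: subset_itvl.
have VtS : Num.sqrt (V t) <= S t by rewrite ler_sqrt ?lerDl ?ltW// Spos.
have S0 : S 0 <= Num.sqrt (V 0) + eps.
  have s0 : 0 <= Num.sqrt (V 0) := sqrtr_ge0 _.
  rewrite /S -[leRHS]ger0_norm; last by rewrite addr_ge0// ltW.
  rewrite -sqrtr_sqr ler_sqrt ?sqr_ge0//.
  by rewrite sqrrD sqr_sqrtr ?V0// lerD2r lerDl mulrn_wge0// mulr_ge0// ltW.
move: Wle; rewrite /W mulr0 expR0 mul1r => Wle.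
have E : expR (- (c * t)) * expR (c * t) = 1 by rewrite -expRD addNr expR0.
(* The [eps] from [S 0] cancels the one in [- k] at time 0, leaving a total excess of exactly
   [eps]. *)
have := ler_wpM2l (expR_ge0 (- (c * t))) Wle; rewrite mulrA E mul1r.
have := ler_wpM2l (expR_ge0 (- (c * t))) S0; rewrite /k.
lra.
Qed.

(** * Limit superior, continuity and distance to the kernel *)

Lemma limf_esup_pinfty_le {K : realType} (g h : K -> K) (l : K) :
  (\forall t \near +oo, g t <= h t) -> h t @[t --> +oo] --> l ->
  (limf_esup (fun t => (g t)%:E) (pinfty_nbhs K) <= l%:E)%E.
Proof.
move=> gh hl; apply/lee_addgt0Pr => eps eps0; rewrite limf_esupE.
(* The limit superior is an infimum of suprema over neighbourhoods of [+oo]; the sublevel set of [g]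
   at [l + eps] is such a neighbourhood. *)
apply: ge_ereal_inf; exists (ereal_sup ((fun t => (g t)%:E) @` [set t | g t <= l + eps])).
  exists [set t | g t <= l + eps] => //=.
  near=> t; apply: (@le_trans _ _ (h t)); first by near: t.
  by near: t; apply: (cvgr_le _ hl); rewrite ltrDl.
by apply: ge_ereal_sup => _ [t /= tle <-]; rewrite -EFinD lee_fin.
Unshelve. all: by end_near. Qed.

(** [T] is arbitrary so that it can be the half-line with its subspace topology. *)
Lemma dot_affine_continuous {K : realType} {T : topologicalType} {m n : nat}
    (R : 'M[K]_(m, n)) (p : 'cV[K]_n) (f : T -> 'cV[K]_n) :
  (forall i, continuous (fun s => f s i 0)) ->
  continuous (fun s => dot (R *m (f s - p)) (R *m (f s - p))).
Proof.
move=> fcont; have coordE i s :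
    (R *m (f s - p)) i 0 = \sum_(j < n) R i j * (f s j 0 - p j 0).
  by rewrite mxE; apply: eq_bigr => j _; rewrite !mxE.
have coord_cont i : continuous (fun s => (R *m (f s - p)) i 0).
  under eq_fun do rewrite coordE.
  apply: continuous_big => [|j _ s]; first exact: add_continuous.
  apply: cvgM; first exact: cvg_cst.
  by apply: cvgB; [exact: fcont|exact: cvg_cst].
under eq_fun do rewrite dotE.
apply: continuous_big => [|i _ s]; first exact: add_continuous.
by apply: cvgM; exact: coord_cont.
Qed.

(** Kernel vectors do not change the seminorm, so the infimum runs over a singleton. *)
Lemma dist_kerE {K : realType} {m n : nat} (R : 'M[K]_(m, n)) x y :
  dist_ker R x y = seminorm R (x - y).
Proof.
rewrite /dist_ker (_ : [set _ | _ in _] = [set seminorm R (x - y)]) ?inf1//.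
have shift v : ker R v -> seminorm R (x - (y + v)) = seminorm R (x - y).
  by move=> Rv0; rewrite /seminorm opprD addrA mulmxBr Rv0 subr0.
apply/seteqP; split => [_ [v Rv0 <-]|_ ->]; first exact: shift.
by exists 0; rewrite /ker/= ?mulmx0// addr0.
Qed.

Lemma Rmat_orthonormal {K : realType} {N : nat} (Rt : 'M[K]_(N.-1, N)) :
  Rt *m Rt^T = 1%:M -> Rmat Rt *m (Rmat Rt)^T = 1%:M.
Proof.
move=> RtRt; rewrite /Rmat tr_block_mx mulmx_block !trmx0 trmx1.
by rewrite !mul0mx !mulmx0 !addr0 add0r mulmx1 RtRt -scalar_mx_block.
Qed.

(** * Deviation from the nominal equilibrium *)

Theorem corollary4 (K : realType) (N : nat) (Rt : 'M[K]_(N.-1, N))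
    (U D : set 'cV[K]_(N + N))
    (f : 'cV[K]_(N + N) -> 'cV[K]_(N + N) -> 'cV[K]_(N + N))
    (u : K -> 'cV[K]_(N + N)) (ubar : 'cV[K]_(N + N))
    (xstar : 'cV[K]_(N + N) -> 'cV[K]_(N + N))
    (x xc : K -> 'cV[K]_(N + N)) (c delta Lu rho0 : K) :
  let R := Rmat Rt in
  (2 <= N)%N ->
  ones_perp_basis Rt ->
  convex_set D ->
  (forall w, U w -> C1 (f ^~ w)) ->
  (forall t : K, 0 <= t -> U (u t)) ->
  0 < c ->
  semi_contracting R f u D c ->
  ker_invariant R f u D ->
  U ubar ->
  D (xstar ubar) ->
  seminorm R (f (xstar ubar) ubar) = 0 ->
  (forall t : K, 0 <= t -> norm2 (u t - ubar) <= delta) ->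
  (forall t : K, xc t = xstar ubar) ->
  0 <= Lu ->
  (forall w, U w ->
    seminorm R (f (xstar ubar) w - f (xstar ubar) ubar)
      <= Lu * norm2 (w - ubar)) ->
  solution f u x ->
  (forall t : K, 0 <= t -> D (x t)) ->
  dist_ker R (x 0) (xc 0) <= rho0 ->
  (forall t : K, 0 <= t ->
    dist_ker R (x t) (xc t)
      <= expR (- (c * t)) * rho0 + Lu * delta / c * (1 - expR (- (c * t)))) /\
  (limf_esup (fun t => (dist_ker R (x t) (xc t))%:E) (pinfty_nbhs K)
     <= (Lu * delta / c)%:E)%E.
Proof.
move=> R _ [RtRt _] Dconv fC1 Uu c0 fcontr fker Uubar Dp fp0 udelta xcE Lu0 fLip.
move=> [xcont xd] Dx rho0_ge.
have RRt : R *m R^T = 1%:M := Rmat_orthonormal _ RtRt.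
set p := xstar ubar in Dp fp0 fLip xcE *.
have delta0 : 0 <= delta := le_trans (norm2_ge0 _) (udelta 0 (lexx 0)).
have b0 : 0 <= Lu * delta by rewrite mulr_ge0.
(* At [p] the nominal field vanishes in seminorm, so only the input mismatch contributes. *)
have nominal_le t : 0 <= t -> seminorm R (f p (u t)) <= Lu * delta.
  move=> t0; rewrite -[f p (u t)](subrK (f p ubar)) /seminorm mulmxDr.
  apply: (le_trans (ler_norm2D _ _)); rewrite -/(seminorm R (f p ubar)) fp0 addr0.
  apply: (le_trans (fLip _ (Uu _ t0))).
  by rewrite ler_wpM2l// udelta.
pose V t := dot (R *m (x t - p)) (R *m (x t - p)).
have sqrtV t : Num.sqrt (V t) = seminorm R (x t - p) by rewrite /seminorm norm2E.
have Vd (t : K) : 0 < t ->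
    is_derive t 1 V (2 * dot (R *m (x t - p)) (R *m f (x t) (u t))).
  move=> t0; have xdt := xd t t0.
  have ed : is_derive t 1 (fun t => R *m (x t - p)) (R *m f (x t) (u t)).
    by apply: is_derive_mulmx; apply: is_derive_eq; rewrite subr0.
  apply: is_derive_eq; first exact: is_derive_dot.
  by rewrite (dotC (R *m f _ _)) mulr_natl mulr2n.
(* Split [f (x t) (u t)] at [f p (u t)]: contraction with the input frozen at [u t] bounds the
   difference, Cauchy-Schwarz and [nominal_le] the remainder. *)
have Vle t : 0 < t -> 2 * dot (R *m (x t - p)) (R *m f (x t) (u t)) <=
    2 * (Lu * delta * Num.sqrt (V t) - c * V t).
  move=> /ltW t0; rewrite ler_pM2l// sqrtV.
  have -> : V t = seminorm R (x t - p) ^+ 2 by rewrite /seminorm sqr_norm2.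
  rewrite -[f (x t) (u t)](subrK (f p (u t))) [R *m (_ - _ + _)]mulmxDr dotDr.
  have h1 := contracting_one_sided_lipschitz R (f ^~ (u t)) D c (x t) p RRt Dconv
    (fC1 _ (Uu t t0)).1 (fun q Dq => fcontr q t Dq t0)
    (fun q v Dq => fker q t v Dq t0) (Dx t t0) Dp.
  have h2 := dot_le_norm2 (R *m (x t - p)) (R *m f p (u t)).
  have := ler_wpM2l (norm2_ge0 (R *m (x t - p))) (nominal_le t t0).
  by move: h1 h2; rewrite /seminorm; lra.
have Vcont : {within `[0, +oo[, continuous V}.
  apply: dot_affine_continuous => i.
  apply: (within_continuous_comp _ x (fun y => y i 0) _ xcont) => y _.
  exact: coord_continuous.
pose bound t := expR (- (c * t)) * rho0 + Lu * delta / c * (1 - expR (- (c * t))).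
have dist_le t : 0 <= t -> dist_ker R (x t) (xc t) <= bound t.
  move=> t0; rewrite dist_kerE xcE -sqrtV.
  have := gronwall_sqrt V _ _ _ c0 b0 Vcont (fun t _ => dotvv_ge0 _) Vd Vle t t0.
  move=> /le_trans; apply.
  by rewrite lerD2r ler_wpM2l ?expR_ge0// sqrtV -(xcE 0) -dist_kerE.
split=> //; apply: (limf_esup_pinfty_le _ bound).
  by near=> t; apply: dist_le; near: t; exact: nbhs_pinfty_ge.
have expR_cvg : expR (- (c * t)) @[t --> +oo] --> 0.
  apply: (cvg_comp _ _ _ (@cvgr_expR K)).
  exact: gt0_cvgMry.
have : bound t @[t --> +oo] --> 0 * rho0 + Lu * delta / c * (1 - 0).
  apply: cvgD; apply: cvgM; [exact: expR_cvg|exact: cvg_cst|exact: cvg_cst|].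
  by apply: cvgB; [exact: cvg_cst|exact: expR_cvg].
by rewrite mul0r add0r subr0 mulr1.
Unshelve. all: by end_near. Qed.
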